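(* Let $G$ be a connected bipartite graph. Then $G$ is Parikh ternary word representable if and only if the two parts of $G$ can be named $X$ and $Y$ (with $G=(X,Y,E)$) so that there exists a linear ordering of $Y$ such that for every $x\in X$, $N(x)$ is either an initial segment or an end segment of $Y$.
   Context: $N(v)$ denotes the open neighborhood of a vertex $v$. An initial (resp. end) segment of a linearly ordered set $Y$ is a subset $S$ such that $y\in S$ and $y'<y$ (resp. $y'>y$) imply $y'\in S$. For an ordered alphabet $\Sigma=\{a_1<\dots<a_s\}$ and a nonempty word $w=w_1\cdots w_n$ over $\Sigma$, the Parikh graph $\mathcal{G}(w)$ is the simple undirected graph on $\{1,\dots,n\}$ where, for $i<j$, $i$ and $j$ are adjacent iff $w_i=a_k$ and $w_j=a_{k+1}$ for some $1\le k\le s-1$. A graph is Parikh ternary word representable if it is isomorphic to $\mathcal{G}(w)$ for some nonempty word $w$ over an ordered alphabet with exactly three letters (equivalently, over $\{a<b<c\}$). *)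

(* Defs.v *)
From mathcomp Require Import all_boot.

Set Implicit Arguments.
Unset Strict Implicit.
Unset Printing Implicit Defensive.

(* A finite simple graph is a symmetric irreflexive relation on a finType.    *)

Definition neighborhood (T : finType) (e : rel T) (v : T) : {set T} :=
  [set u | e v u].

(* The empty graph is not connected. *)
Definition connected_graph (T : finType) (e : rel T) : Prop :=
  0 < #|T| /\ forall u v : T, connect e u v.

(* Parts may be empty, so that the one-vertex graph is bipartite. *)
Definition is_bipartition (T : finType) (e : rel T) (X Y : {set T}) : Prop :=
  [/\ X :|: Y = [set: T], X :&: Y = set0
    & forall u v : T, e u v -> (u \in X /\ v \in Y) \/ (u \in Y /\ v \in X)].

Definition bipartite (T : finType) (e : rel T) : Prop :=
  exists X Y : {set T}, is_bipartition e X Y.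

(* [r] is a non-strict order; only its restriction to [Y] matters. *)
Definition linear_order_on (T : finType) (Y : {set T}) (r : rel T) : Prop :=
  [/\ {in Y, reflexive r}, {in Y &, antisymmetric r},
      {in Y & &, transitive r} & {in Y &, total r}].

Definition initial_segment (T : finType) (Y : {set T}) (r : rel T)
    (S : {set T}) : Prop :=
  S \subset Y /\
  forall y y' : T, y \in S -> y' \in Y -> y' != y -> r y' y -> y' \in S.

Definition end_segment (T : finType) (Y : {set T}) (r : rel T)
    (S : {set T}) : Prop :=
  S \subset Y /\
  forall y y' : T, y \in S -> y' \in Y -> y' != y -> r y y' -> y' \in S.

(* The alphabet a_1 < ... < a_s is 'I_s, the letter a_k being the ordinal     *)
(* k - 1; the positions 1, ..., n of a word are likewise numbered from 0.     *)
Definition parikh_graph (s n : nat) (w : n.-tuple 'I_s) : rel 'I_n :=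
  fun i j =>
    ((i < j) && (val (tnth w j) == (val (tnth w i)).+1))
    || ((j < i) && (val (tnth w i) == (val (tnth w j)).+1)).

Lemma parikh_graph_sym (s n : nat) (w : n.-tuple 'I_s) :
  symmetric (parikh_graph w).
Proof. by move=> i j; rewrite /parikh_graph orbC. Qed.

Lemma parikh_graph_irrefl (s n : nat) (w : n.-tuple 'I_s) :
  irreflexive (parikh_graph w).
Proof. by move=> i; rewrite /parikh_graph ltnn. Qed.

Definition graph_isomorphic (T U : finType) (e : rel T) (e' : rel U) : Prop :=
  exists2 f : T -> U, bijective f & forall u v : T, e u v = e' (f u) (f v).

Definition parikh_representable (s : nat) (T : finType) (e : rel T) : Prop :=
  exists (n : nat) (w : n.-tuple 'I_s),
    0 < n /\ graph_isomorphic e (parikh_graph w).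

Definition parikh_ternary_representable (T : finType) (e : rel T) : Prop :=
  parikh_representable 3 e.

(* Main.v *)
Require Import Defs.
From mathcomp Require Import all_boot.
From mathcomp Require Import zify.

(** In a ternary word over [a < b < c] a letter [a] is adjacent to the [b]'s
    after it, an end segment of the [b]'s in word order, and a letter [c] to the
    [b]'s before it, an initial segment.  Conversely, write the elements of [Y]
    in order as [b]'s and insert, for each [x] in [X], a [c] right after [N(x)]
    if [N(x)] is initial, or else an [a] right before [N(x)]. *)

(** For a linear order, the zero-based position of [y] in [Y]. Since [r] is non-strict, [y] itself
    is excluded. *)
Definition rank_in {T : finType} (Y : {set T}) (r : rel T) (y : T) : nat :=
  #|[set z in Y | (z != y) && r z y]|.

(** For [y] in [S], the elements below [y] form a subset of [S] that misses [y], hence a proper one.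
    For [y] outside [S], totality puts all of [S] below [y]. *)
Lemma initial_segment_rank {T : finType} {Y : {set T}} {r : rel T}
    (r_total : {in Y &, total r}) (S : {set T}) :
  initial_segment Y r S ->
  {in Y, forall y, (y \in S) = (rank_in Y r y < #|S|)}.
Proof.
move=> [SY Sinit] y yY; rewrite /rank_in; case: (boolP (y \in S)) => yS.
  apply/esym/proper_card/properP; split; last by exists y; rewrite // inE eqxx andbF.
  by apply/subsetP => z; rewrite inE => /and3P [zY zy rzy]; apply: Sinit rzy.
apply/esym/negbTE; rewrite -leqNgt; apply/subset_leq_card/subsetP => z zS.
have zY := subsetP SY z zS.
have zy : z != y by apply: contraNneq yS => <-.
rewrite inE zY zy /=; case/orP: (r_total _ _ zY yY) => // ryz.
by case/negP: yS; apply: Sinit ryz; rewrite // eq_sym.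
Qed.

Lemma end_segment_setD {T : finType} (Y : {set T}) (r : rel T) (S : {set T}) :
  end_segment Y r S -> initial_segment Y r (Y :\: S).
Proof.
move=> [SY Send]; split; first exact: subsetDl.
move=> y y'; rewrite !inE => /andP [yS yY] y'Y y'y ry'y; rewrite y'Y andbT.
by apply: contra yS => y'S; apply: Send ry'y; rewrite // eq_sym.
Qed.

Lemma end_segment_rank {T : finType} {Y : {set T}} {r : rel T}
    (r_total : {in Y &, total r}) (S : {set T}) :
  end_segment Y r S ->
  {in Y, forall y, (y \in S) = (#|Y :\: S| <= rank_in Y r y)}.
Proof.
move=> /end_segment_setD /(initial_segment_rank r_total) rankD y yY.
by rewrite leqNgt -rankD // inE yY andbT negbK.
Qed.

(** Turns keys into word positions: [f] is the index in the list of vertices sorted by key, with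
    ties broken arbitrarily. *)
Lemma ord_bij_of_key (T : finType) (key : T -> nat) :
  exists2 f : T -> 'I_#|T|, bijective f &
    forall u v, key u < key v -> f u < f v.
Proof.
pose le_key u v := key u <= key v; pose s := sort le_key (enum T).
have le_key_trans : transitive le_key by move=> x y z; apply: leq_trans.
have s_sorted : sorted le_key s by apply: sort_sorted => x y; apply: leq_total.
have mem_s x : x \in s by rewrite mem_sort mem_enum.
have index_lt x : index x s < #|T|.
  by rewrite cardE -(size_sort le_key) index_mem mem_s.
exists (fun x => Ordinal (index_lt x)).
  apply: inj_card_bij; last by rewrite card_ord.
  by move=> x y [] /index_inj; apply.
move=> u v /= lt_uv; rewrite ltn_neqAle; apply/andP; split.
  by apply: contraTneq lt_uv => /index_inj-> //; rewrite ltnn.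
rewrite leqNgt; apply: contraTN lt_uv => lt_vu; rewrite -leqNgt.
exact: (sorted_ltn_index le_key_trans s_sorted).
Qed.

Lemma parikh_ternary_segments (T : finType) (e : rel T) :
  parikh_ternary_representable e ->
  exists X Y : {set T},
    is_bipartition e X Y /\
    exists r : rel T,
      linear_order_on Y r /\
      forall x : T, x \in X ->
        initial_segment Y r (neighborhood e x) \/
        end_segment Y r (neighborhood e x).
Proof.
move=> [n [w [_ [f /bij_inj f_inj ef]]]].
pose l v := tnth w (f v); pose Y := [set v | val (l v) == 1].
have eE u v : e u v = ((f u < f v) && (val (l v) == (val (l u)).+1))
                   || ((f v < f u) && (val (l u) == (val (l v)).+1)).
  exact: ef.
exists (~: Y), Y; split.
  split; [by rewrite setUC setUCr | by rewrite setIC setICr | move=> u v].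
  (* Of two consecutive values below 3, exactly one is 1. *)
  rewrite eE !inE; move: (ltn_ord (l u)) (ltn_ord (l v)) => /=; lia.
pose r : rel T := fun u v => f u <= f v.
have r_linear : linear_order_on Y r.
  split=> [u _|u v _ _ uv|u v t _ _ _|u v _ _]; rewrite /r ?leqnn //.
  - exact/f_inj/val_inj/anti_leq.
  - exact: leq_trans.
  - exact: leq_total.
exists r; split=> //.
move=> x; rewrite !inE; have : val (l x) < 3 by apply: ltn_ord.
(* Letter 0 gives an end segment and letter 2 an initial one; letter 1 would put [x] in [Y]. *)
case lx: (val (l x)) => [|[|[|k]]] // _ _; [right|left]; split.
1,3: by apply/subsetP => y; have /= := ltn_ord (l y); rewrite !inE eE lx /=; lia.
all: by move=> y y'; have /= := ltn_ord (l y); rewrite !inE !eE lx /r /=; lia.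
Qed.

Lemma segments_parikh_ternary (T : finType) (e : rel T) (X Y : {set T})
    (r : rel T) :
  symmetric e -> 0 < #|T| -> is_bipartition e X Y -> {in Y &, total r} ->
  (forall x : T, x \in X ->
     initial_segment Y r (neighborhood e x) \/
     end_segment Y r (neighborhood e x)) ->
  parikh_ternary_representable e.
Proof.
move=> e_sym T_gt0 [XUY XIY eXY] r_total segX.
pose rk := rank_in Y r; pose N := neighborhood e.
(* A boolean test for [N x] being initial, through the rank criterion. If [N x] is both initial and
   end, [x] becomes a [c]. *)
pose is_c x := [forall y in Y, (y \in N x) == (rk y < #|N x|)].
pose l v : 'I_3 := inord (if v \in Y then 1 else if is_c v then 2 else 0).
(* Odd keys for the [b]'s leave even ones for the gaps between them. *)
pose key v := if v \in Y then (rk v).*2.+1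
              else if is_c v then #|N v|.*2 else #|Y :\: N v|.*2.
have [f f_bij f_key] := ord_bij_of_key T key.
case: (f_bij) => g fK _.
exists #|T|, [tuple l (g i) | i < #|T|]; split=> //; exists f => // u v.
rewrite /parikh_graph !tnth_mktuple !fK.
have lE z : val (l z) = if z \in Y then 1 else if is_c z then 2 else 0.
  by rewrite /l /= inordK //; case: ifP => // _; case: ifP.
have inX z : (z \in X) = (z \notin Y).
  move/setP/(_ z): XUY; move/setP/(_ z): XIY; rewrite !inE.
  by case: (z \in X); case: (z \in Y).
(* The keys of [x] and [y] differ in parity, so [f_key] always decides their order in the word. *)
have mixed x y : x \notin Y -> y \in Y ->
    e x y = if is_c x then f y < f x else f x < f y.
  move=> xY yY; have := f_key x y; have := f_key y x.
  rewrite /key yY (negbTE xY).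
  have -> : e x y = (y \in N x) by rewrite inE.
  case: (boolP (is_c x)) => [/forall_inP/(_ y yY)/eqP ->|]; first by lia.
  (* When [is_c x] fails, the initial case is contradictory, so [N x] is an end segment and
     [#|Y :\: N x|] is the rank where it starts. *)
  case: (segX x); rewrite ?inX //.
    move=> /(initial_segment_rank r_total) Nx /forall_inP; case.
    by move=> z zY; apply/eqP/Nx.
  by move=> /(end_segment_rank r_total)/(_ y yY) Nx _; move: Nx; rewrite /rk /N; lia.
(* Only pairs with one vertex in [Y] depend on positions: two letters 1, or two letters among 0 and
   2, are never consecutive, so ties in the keys are harmless. *)
rewrite !lE; case: (boolP (u \in Y)) => uY; case: (boolP (v \in Y)) => vY.
- rewrite !andbF; apply/negP => /eXY; rewrite !inX uY vY /=; by case=> [] [].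
- by rewrite e_sym (mixed _ _ vY uY); case: (is_c v); rewrite /= ?andbT ?andbF ?orbF.
- by rewrite (mixed _ _ uY vY); case: (is_c u); rewrite /= ?andbT ?andbF ?orbF.
- have -> : e u v = false.
    by apply/negP => /eXY; rewrite (negbTE uY) (negbTE vY); case=> [] [].
  by case: (is_c u); case: (is_c v); rewrite /= !andbF.
Qed.

Theorem theorem6p3 (T : finType) (e : rel T)
    (e_sym : symmetric e) (e_irrefl : irreflexive e)
    (e_connected : connected_graph e) (e_bipartite : bipartite e) :
  parikh_ternary_representable e <->
  exists X Y : {set T},
    is_bipartition e X Y /\
    exists r : rel T,
      linear_order_on Y r /\
      forall x : T, x \in X ->
        initial_segment Y r (neighborhood e x) \/
        end_segment Y r (neighborhood e x).
Proof.
split; first exact: parikh_ternary_segments.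
move=> [X [Y [bipXY [r [[_ _ _ r_total] segX]]]]].
have [T_gt0 _] := e_connected.
exact: segments_parikh_ternary e_sym T_gt0 bipXY r_total segX.
Qed.
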